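(* Let $F,F'$ be non-archimedean local fields with rings of integers $\mathcal O,\mathcal O'$ and uniformizers $\pi,\pi'$, whose residue fields have the same order. Let $r\ge1$, $\mathcal O_r=\mathcal O/\pi^r\mathcal O$ and $\mathcal O'_r=\mathcal O'/\pi'^r\mathcal O'$. Then the free projective planes $\mathbb P^2_{\mathrm{fr}}(\mathcal O_r)$ and $\mathbb P^2_{\mathrm{fr}}(\mathcal O'_r)$ are isospectral graphs.
   Context: For a finite local ring $R$ of this form, $\mathbb P^2_{\mathrm{fr}}(R)$ is the graph whose vertices are the free $R$-submodules $0<M<R^3$ (proper, nonzero), where two distinct submodules are adjacent iff one is contained in the other. Two finite graphs are isospectral if their adjacency matrices have the same eigenvalues with the same multiplicities. *)

(* Defs.v *)
From HB Require Import structures.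
From mathcomp Require Import all_boot all_order all_algebra all_field.
From mathcomp Require Import ring_quotient boolp.

Set Implicit Arguments.
Unset Strict Implicit.
Unset Printing Implicit Defensive.

Import Order.TTheory GRing.Theory Num.Theory.
Local Open Scope ring_scope.

(* The value of the valuation at 0, which should be +oo, is left unspecified;
   [val_ge n x] is the comparison n <= v x in Z with +oo adjoined. *)
HB.mixin Record isDiscretelyValued F of GRing.Field F := {
  valuation : F -> int;
  valuationM_subproof : forall x y : F, x != 0 -> y != 0 ->
    valuation (x * y) = valuation x + valuation y;
  valuationD_subproof : forall x y : F, x != 0 -> y != 0 -> x + y != 0 ->
    Order.min (valuation x) (valuation y) <= valuation (x + y);
  valuation_normalized : exists2 x : F, x != 0 & valuation x = 1
}.

#[short(type="dvFieldType")]
HB.structure Definition DVField := {F of isDiscretelyValued F & GRing.Field F}.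

Arguments valuation : simpl never.

Definition val_ge (F : dvFieldType) (n : int) (x : F) : bool :=
  (x == 0) || (n <= valuation x).

Section ValuationTheory.
Variable F : dvFieldType.
Implicit Types x y : F.

Lemma valuationM x y :
  x != 0 -> y != 0 -> valuation (x * y) = valuation x + valuation y.
Proof. exact: valuationM_subproof. Qed.

Lemma valuationD x y : x != 0 -> y != 0 -> x + y != 0 ->
  Order.min (valuation x) (valuation y) <= valuation (x + y).
Proof. exact: valuationD_subproof. Qed.

Lemma val_ge0r n : val_ge n (0 : F).
Proof. by rewrite /val_ge eqxx. Qed.

Lemma valuation1 : valuation (1 : F) = 0.
Proof.
have := @valuationM 1 1 (oner_neq0 F) (oner_neq0 F).
by rewrite mulr1 -{1}[valuation 1]addr0 => /addrI.
Qed.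

Lemma valuationV x : x != 0 -> valuation x^-1 = - valuation x.
Proof.
move=> x0; apply/eqP; rewrite -addr_eq0 -valuationM ?invr_neq0 //.
by rewrite mulVf // valuation1.
Qed.

Lemma valuationN1 : valuation (-1 : F) = 0.
Proof.
have N0 : (-1 : F) != 0 by rewrite oppr_eq0 oner_neq0.
have := @valuationM (-1) (-1) N0 N0.
rewrite mulrNN mulr1 valuation1 => /esym/eqP.
by rewrite -mulr2n mulrn_eq0 /= => /eqP.
Qed.

Lemma val_geM m n x y : val_ge m x -> val_ge n y -> val_ge (m + n) (x * y).
Proof.
rewrite /val_ge mulf_eq0; case: eqP => //= /eqP x0; case: eqP => //= /eqP y0.
by move=> mx ny; rewrite valuationM // lerD.
Qed.

Lemma val_geD n x y : val_ge n x -> val_ge n y -> val_ge n (x + y).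
Proof.
have [->|x0] := eqVneq x 0; first by rewrite add0r.
have [->|y0] := eqVneq y 0; first by rewrite addr0.
have [->|xy0] := eqVneq (x + y) 0; first by rewrite val_ge0r.
rewrite /val_ge (negPf x0) (negPf y0) (negPf xy0) /= => nx ny.
by apply: le_trans (valuationD x0 y0 xy0); rewrite le_min nx ny.
Qed.

Lemma val_ge1 : val_ge 0 (1 : F).
Proof. by rewrite /val_ge valuation1 lexx orbT. Qed.

Lemma val_geN n x : val_ge n x -> val_ge n (- x).
Proof.
by rewrite -mulN1r -{2}[n]add0r; apply: val_geM; rewrite /val_ge valuationN1 orbT.
Qed.

End ValuationTheory.

Definition integral_pred (F : dvFieldType) : {pred F} := val_ge 0.

Lemma integral_subring_closed F : subring_closed (@integral_pred F).
Proof.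
split=> [|x y xO yO|x y xO yO]; first exact: val_ge1.
  exact/val_geD/val_geN.
by rewrite /in_mem /= /integral_pred -[0]addr0; apply: val_geM.
Qed.

HB.instance Definition _ (F : dvFieldType) :=
  GRing.isSubringClosed.Build F (@integral_pred F) (integral_subring_closed F).

Record int_ring (F : dvFieldType) :=
  IntRing { int_ring_val :> F; _ : int_ring_val \in @integral_pred F }.

HB.instance Definition _ F := [isSub of int_ring F for @int_ring_val F].
HB.instance Definition _ F := [Choice of int_ring F by <:].
HB.instance Definition _ F := [SubChoice_isSubComNzRing of int_ring F by <:].

Definition max_ideal (F : dvFieldType) : {pred int_ring F} :=
  fun x => val_ge 1 (val x).

Lemma max_ideal_closed F : idealr_closed (@max_ideal F).
Proof.
split=> [||a x y xm ym].
- by rewrite unfold_in rmorph0 val_ge0r.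
- by rewrite unfold_in rmorph1 /val_ge oner_eq0 valuation1.
- rewrite unfold_in rmorphD rmorphM; apply: val_geD => //.
  by rewrite -[1]add0r; apply: val_geM => //; apply: (valP a).
Qed.

HB.instance Definition _ (F : dvFieldType) :=
  isIdealr.Build (int_ring F) (@max_ideal F) (@max_ideal_closed F).

Definition residue_field (F : dvFieldType) : Type :=
  {ideal_quot (@max_ideal F)}.
HB.instance Definition _ F := GRing.ComNzRing.on (residue_field F).

Definition val_cauchy (F : dvFieldType) (u : nat -> F) : Prop :=
  forall k : int, exists N, forall m n, (N <= m)%N -> (N <= n)%N ->
    val_ge k (u m - u n).

Definition val_cvg (F : dvFieldType) (u : nat -> F) (l : F) : Prop :=
  forall k : int, exists N, forall n, (N <= n)%N -> val_ge k (u n - l).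

HB.mixin Record DVField_isLocal F of DVField F := {
  val_complete : forall u : nat -> F, val_cauchy u -> exists l, val_cvg u l;
  residue_finite : exists s : seq (residue_field F), forall x, x \in s
}.

(* A non-archimedean local field is taken to be a field complete for a discrete
   valuation with finite residue field. *)
#[short(type="localFieldType")]
HB.structure Definition LocalField := {F of DVField_isLocal F & DVField F}.

Section FiniteOfEnum.
Variables (T : choiceType) (finT : exists s : seq T, forall x, x \in s).

Definition enum_of_ex : seq T := undup (projT1 (cid finT)).

Lemma mem_enum_of_ex x : x \in enum_of_ex.
Proof. by rewrite mem_undup; case: (cid finT) => s /= ->. Qed.

Lemma enum_of_ex_axiom : Finite.axiom enum_of_ex.
Proof.
by move=> x; rewrite count_uniq_mem ?undup_uniq // mem_enum_of_ex.
Qed.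

Lemma enum_of_ex_pcan :
  pcancel (index^~ enum_of_ex) (fun n => nth None (map some enum_of_ex) n).
Proof.
by move=> x; rewrite (nth_map x) ?nth_index ?index_mem ?mem_enum_of_ex.
Qed.
End FiniteOfEnum.

HB.instance Definition _ (F : localFieldType) :
    isCountable (residue_field F) :=
  PCanIsCountable (enum_of_ex_pcan (residue_finite (s := F))).
HB.instance Definition _ (F : localFieldType) :=
  isFinite.Build (residue_field F) (enum_of_ex_axiom (residue_finite (s := F))).

Record uniformizer (F : dvFieldType) := Uniformizer {
  unif :> int_ring F;
  _ : (unif != 0) && (valuation (val unif) == 1)
}.

(* The ideal generated by ['pi^r]; [r_gt0] only serves to make it proper. *)
Definition pow_ideal (F : dvFieldType) (pi : uniformizer F) (r : nat)
    (r_gt0 : (0 < r)%N) : {pred int_ring F} :=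
  fun x => `[< exists y : int_ring F, x = (pi : int_ring F) ^+ r * y >].

Section PowIdeal.
Variables (F : dvFieldType) (pi : uniformizer F).

Lemma unif_neq0 : val (pi : int_ring F) != 0.
Proof. by case: pi => p /= /andP[p0 _]; rewrite -(inj_eq val_inj) /= in p0. Qed.

Lemma unif_val : valuation (val (pi : int_ring F)) = 1.
Proof. by case: pi => p /= /andP[_ /eqP]. Qed.

Lemma max_idealP (x : int_ring F) :
  x \in @max_ideal F -> exists y, x = (pi : int_ring F) * y.
Proof.
rewrite unfold_in => xm.
have yO : val x / val (pi : int_ring F) \in @integral_pred F.
  rewrite unfold_in; apply: (@val_geM _ 1 (-1)) => //.
  by rewrite /val_ge valuationV ?unif_neq0 // unif_val lexx orbT.
exists (IntRing yO); apply: val_inj.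
by rewrite rmorphM /= mulrC divfK // unif_neq0.
Qed.

Lemma unif_max (y : int_ring F) : (pi : int_ring F) * y \in @max_ideal F.
Proof.
rewrite unfold_in rmorphM -[1]addr0; apply: val_geM; last exact: (valP y).
by rewrite /val_ge unif_val lexx orbT.
Qed.

Variables (r : nat) (r_gt0 : (0 < r)%N).

Lemma pow_ideal_closed : idealr_closed (pow_ideal pi r_gt0).
Proof.
split=> [||a x y /asboolP[b ->] /asboolP[c ->]].
- by apply/asboolP; exists 0; rewrite mulr0.
- apply/asboolP=> -[y]; case: r r_gt0 => // k _; rewrite exprS -mulrA => e.
  by have := unif_max (unif pi ^+ k * y); rewrite -e idealr1.
- by apply/asboolP; exists (a * b + c); rewrite mulrDr mulrCA.
Qed.

HB.instance Definition _ :=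
  isIdealr.Build (int_ring F) (pow_ideal pi r_gt0) pow_ideal_closed.

Definition int_quot : Type := {ideal_quot (pow_ideal pi r_gt0)}.
HB.instance Definition _ := GRing.ComNzRing.on int_quot.
End PowIdeal.

Section IntQuotFinite.
Variables (F : localFieldType) (pi : uniformizer F) (r : nat).
Hypothesis r_gt0 : (0 < r)%N.

Lemma int_ring_representatives k : exists t : seq (int_ring F),
  forall x, exists2 y, y \in t & exists z, x = y + (pi : int_ring F) ^+ k * z.
Proof.
elim: k => [|k [t ht]].
  by exists [:: 0] => x; exists 0; [rewrite inE | exists x; rewrite add0r mul1r].
have [s hs] := residue_finite (s := F).
exists [seq y + unif pi ^+ k * repr c | y <- t, c <- s] => x.
have [y yt [z ->]] := ht x.
pose c : residue_field F := (\pi_{ideal_quot (@max_ideal F)} z)%qT.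
have /max_idealP-/(_ pi)[w hw] : z - repr c \in @max_ideal F.
  by rewrite Quotient.idealrBE reprK.
exists (y + unif pi ^+ k * repr c); first exact: allpairs_f.
by exists w; rewrite exprSr -mulrA -hw -addrA -mulrDr [_ + (z - _)]addrC subrK.
Qed.

Lemma int_quot_finite : exists s : seq (int_quot pi r_gt0), forall x, x \in s.
Proof.
have [t ht] := int_ring_representatives r.
exists [seq (\pi_{ideal_quot (pow_ideal pi r_gt0)} y)%qT | y <- t] => x.
have [y yt [z e]] := ht (repr x); apply/mapP; exists y => //.
rewrite -[LHS]reprK; apply/eqP; rewrite -Quotient.idealrBE e addrC addKr.
by apply/asboolP; exists z.
Qed.

HB.instance Definition _ : isCountable (int_quot pi r_gt0) :=
  PCanIsCountable (enum_of_ex_pcan int_quot_finite).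
HB.instance Definition _ :=
  isFinite.Build (int_quot pi r_gt0) (enum_of_ex_axiom int_quot_finite).
End IntQuotFinite.

Record sgraph := SGraph {
  vertex :> finType;
  adj : rel vertex;
  adj_sym : symmetric adj;
  adj_irr : irreflexive adj
}.

Definition adj_mx (G : sgraph) : 'M[algC]_#|G| :=
  \matrix_(i, j) (adj (enum_val i : G) (enum_val j))%:R.

(* Multiplicities are those of the roots of the characteristic polynomials;
   [mup a p] is 0 exactly when [a] is not a root of [p != 0]. *)
Definition isospectral (G H : sgraph) : Prop :=
  forall a : algC, mup a (char_poly (adj_mx G)) = mup a (char_poly (adj_mx H)).

Section FreePlane.
Variable R : finComNzRingType.
Implicit Type M : {set 'rV[R]_3}.

(* The rows of [B] form a basis of [M]. *)
Definition is_free_module M : Prop :=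
  exists n (B : 'M[R]_(n, 3)),
    injective (fun c : 'rV[R]_n => c *m B) /\ M = [set c *m B | c : 'rV[R]_n].

Definition free_submodule M : Prop :=
  submod_closed M /\ is_free_module M.

Record free_plane_vertex := FreePlaneVertex {
  fp_module :> {set 'rV[R]_3};
  _ : [&& `[< free_submodule fp_module >],
          [set 0] \proper fp_module & fp_module \proper [set: 'rV[R]_3]]
}.

HB.instance Definition _ := [isSub of free_plane_vertex for fp_module].
HB.instance Definition _ := [Finite of free_plane_vertex by <:].

Definition fp_adj : rel free_plane_vertex := fun P Q =>
  (P != Q) && ((fp_module P \subset Q) || (fp_module Q \subset P)).

Lemma fp_adj_sym : symmetric fp_adj.
Proof. by move=> P Q; rewrite /fp_adj eq_sym orbC. Qed.

Lemma fp_adj_irr : irreflexive fp_adj.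
Proof. by move=> P; rewrite /fp_adj eqxx. Qed.

Definition free_plane : sgraph := SGraph fp_adj_sym fp_adj_irr.
End FreePlane.

(* Main.v *)
(* The quotient R = O / pi^r is a chain ring: its ideals are the powers of p = pi.
   Up to a unit, a unimodular vector of R^3 has a unique normalized form (first
   unit coordinate equal to 1), and the vertices of the free plane are the points
   R c and the lines {d | c . d = 0} for c normalized, with R c inside the line of
   d iff c . d = 0.  So the adjacency matrix is that of the bipartite double of
   the symmetric matrix N = [c . d = 0], and its characteristic polynomial is that
   of N^2 evaluated at X^2.  The entry of N^2 at (c, c') counts the lines through
   two points; it only depends on the largest k <= r with c = c' mod p^k and on
   the size of the ideals of R.  Translating pi-adic digits through a bijection of
   the residue fields gives a bijection O_r -> O'_r respecting all congruences
   modulo powers of the uniformizers; after an affine normalization it fixes 0 and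
   1, hence acts on normalized vectors and matches the two matrices N^2. *)
Require Import Defs.
From HB Require Import structures.
From mathcomp Require Import all_boot all_order all_algebra all_field.
From mathcomp Require Import fingroup perm generic_quotient ring_quotient.
From mathcomp Require Import boolp ring.

Set Implicit Arguments.
Unset Strict Implicit.
Unset Printing Implicit Defensive.

Import GRing.Theory.
Local Open Scope ring_scope.

Lemma injective_surjective_bij (aT bT : choiceType) (h : aT -> bT) :
  injective h -> (forall y, exists x, h x = y) -> bijective h.
Proof.
move=> hI hS.
have hS' y : exists x, h x == y by case: (hS y) => x <-; exists x.
have xK : cancel (fun y => xchoose (hS' y)) h.
  by move=> y; apply/eqP/(xchooseP (hS' y)).
by exists (fun y => xchoose (hS' y)) => // x; apply: hI; rewrite xK.
Qed.

(** * Characteristic polynomials *)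

Section CharPoly.
Variable K : comNzRingType.

(** The bijection forces [n = m], and reindexing is then conjugation by a permutation matrix. *)
Lemma char_poly_mxsub n m (h : 'I_n -> 'I_m) (A : 'M[K]_m) :
  bijective h -> char_poly (mxsub h h A) = char_poly A.
Proof.
move=> hB; have := bij_eq_card hB; rewrite !card_ord => nm.
case: m / nm in h hB A *.
pose s := perm (bij_inj hB).
have -> : mxsub h h A = perm_mx s *m A *m (perm_mx s)^T.
  rewrite -row_permE tr_perm_mx -col_permE.
  by apply/matrixP => i j; rewrite !mxE !permE.
have s1 : perm_mx s *m (perm_mx s)^T = 1%:M :> 'M[{poly K}]_n.
  by rewrite tr_perm_mx -perm_mxM mulgV perm_mx1.
rewrite /char_poly /char_poly_mx.
have -> : 'X%:M - map_mx polyC (perm_mx s *m A *m (perm_mx s)^T) =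
    perm_mx s *m ('X%:M - map_mx polyC A) *m (perm_mx s)^T.
  rewrite !map_mxM -map_trmx map_perm_mx mulmxBr mulmxBl; congr (_ - _).
  by rewrite mul_mx_scalar -scalemxAl s1 scalemx1.
by rewrite !det_mulmx mulrAC -det_mulmx s1 det1 mul1r.
Qed.

(** Right multiplication of the characteristic matrix by the block matrix with rows [('X, 0)] and
    [(P, 1)] makes it block upper triangular, with diagonal blocks ['X^2 - P^2] and ['X]. The factor
    ['X^n] that this puts on both sides is monic, so it cancels over any [K]. *)
Lemma char_poly_antidiag n (N : 'M[K]_n) :
  char_poly (block_mx 0 N N 0) = char_poly (N *m N) \Po 'X^2.
Proof.
pose P : 'M[{poly K}]_n := map_mx polyC N.
have E : char_poly_mx (block_mx 0 N N 0) *m block_mx 'X%:M 0 P 1%:M =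
    block_mx ('X^2%:M - P *m P) (- P) 0 'X%:M.
  rewrite /char_poly_mx map_block_mx !map_mx0 -/P scalar_mx_block.
  rewrite opp_block_mx add_block_mx !(oppr0, addr0, add0r) mulmx_block.
  rewrite !(mulmx0, mulmx1, add0r, addr0, mulNmx, mul0mx) -scalar_mxM.
  by rewrite scalar_mxC addNr.
have dE : (\det ('X^2%:M - P *m P)) = char_poly (N *m N) \Po 'X^2.
  rewrite /char_poly -[X in _ = X](det_map_mx (comp_poly 'X^2)); congr (\det _).
  rewrite /char_poly_mx map_mxB map_scalar_mx /= comp_polyX; congr (_ - _).
  rewrite -map_mxM; apply/matrixP => i j; rewrite !mxE.
  by rewrite comp_polyC.
have := congr1 determinant E.
rewrite det_mulmx det_lblock det_ublock det1 mulr1 dE !det_scalar => /eqP.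
have lr : GRing.lreg ('X ^+ n : {poly K}) by apply/monic_lreg/monicXn.
rewrite /char_poly; set a := \det _; set b := _ \Po _ => /eqP e.
by apply: lr; rewrite mulrC e mulrC.
Qed.
End CharPoly.

(** * Free planes over finite chain rings *)

Section Divisibility.
Variable R : finComNzRingType.
Implicit Types a b u x y : R.

(** Finiteness of [R] makes invertibility and divisibility decidable by search, so both can be
    boolean. *)
Definition is_unit x := [exists y, x * y == 1].
Definition divides a x := [exists y, x == a * y].

Lemma is_unitP x : reflect (exists y, x * y = 1) (is_unit x).
Proof. by apply: (iffP existsP) => -[y /eqP]; exists y => //; apply/eqP. Qed.

Lemma dividesP a x : reflect (exists y, x = a * y) (divides a x).
Proof. by apply: (iffP existsP) => -[y /eqP]; exists y => //; apply/eqP. Qed.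

Lemma is_unit1 : is_unit 1.
Proof. by apply/is_unitP; exists 1; rewrite mulr1. Qed.

Lemma is_unitM x y : is_unit (x * y) = is_unit x && is_unit y.
Proof.
apply/is_unitP/andP=> [[z xyz]|[/is_unitP[a xa] /is_unitP[b yb]]].
  by split; apply/is_unitP; [exists (y * z) | exists (x * z)]; rewrite -xyz; ring.
by exists (a * b); rewrite mulrACA xa yb mulr1.
Qed.

Lemma divides1 x : divides 1 x.
Proof. by apply/dividesP; exists x; rewrite mul1r. Qed.

Lemma divides0 a : divides a 0.
Proof. by apply/dividesP; exists 0; rewrite mulr0. Qed.

Lemma dividesD a x y : divides a x -> divides a y -> divides a (x + y).
Proof.
by move=> /dividesP[b ->] /dividesP[c ->]; apply/dividesP; exists (b + c); ring.
Qed.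

Lemma dividesMl a x y : divides a x -> divides a (y * x).
Proof. by move=> /dividesP[b ->]; apply/dividesP; exists (y * b); ring. Qed.

Lemma dividesMunit a u x : is_unit u -> divides a (u * x) = divides a x.
Proof.
move=> /is_unitP[v uv]; apply/idP/idP; last exact: dividesMl.
by move=> /dividesMl-/(_ v); rewrite mulrA [v * u]mulrC uv mul1r.
Qed.
End Divisibility.

(** Describes a local ring with principal maximal ideal through annihilators: the last clause yields
    [p ^+ r = 0] at [k = r], and then [p ^+ r.-1 != 0] at [k = r.-1], so [r] is the exact nilpotency
    index of [p]. *)
Definition chain_ring (R : finComNzRingType) (p : R) (r : nat) : Prop :=
  [/\ (0 < r)%N, forall x, ~~ is_unit x -> divides p x
    & forall k x, (k <= r)%N -> (p ^+ k * x == 0) = divides (p ^+ (r - k)) x].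

(** * Units and powers of the generator in a chain ring *)

Section ChainRing.
Variables (R : finComNzRingType) (p : R) (r : nat).
Hypothesis chR : chain_ring p r.

Lemma chain_expr0 : p ^+ r = 0.
Proof.
case: chR => _ _ /(_ r 1 (leqnn r)).
by rewrite mulr1 subnn expr0 divides1 => /eqP.
Qed.

(** Converse to the second clause of [chain_ring]: a multiple of [p] is nilpotent, hence not a
    unit. *)
Lemma is_unitE x : is_unit x = ~~ divides p x.
Proof.
case: chR => r0 H _; apply/idP/idP; last by apply: contraNT => /H ->.
move=> /is_unitP[y xy]; apply/negP => /dividesP[z xz].
have : (x * y) ^+ r = 0 by rewrite xz !exprMn chain_expr0; ring.
by rewrite xy expr1n => /eqP; rewrite oner_eq0.
Qed.

Lemma is_unitNE x : ~~ is_unit x = divides p x.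
Proof. by rewrite is_unitE negbK. Qed.

(* [p ^+ r.-1] spans the socle. *)
Lemma socle_eq0 x : (p ^+ r.-1 * x == 0) = ~~ is_unit x.
Proof.
case: chR => r0 _ H; rewrite H ?leq_pred // is_unitNE.
by case: r r0 => // s _; rewrite subSnn expr1.
Qed.

Lemma socle_neq0 : p ^+ r.-1 != 0.
Proof. by rewrite -[p ^+ _]mulr1 socle_eq0 is_unit1. Qed.

(** Peel off [p] from both elements at once as long as neither cofactor is a unit. After [r] rounds
    both elements are 0, and [k = r] with cofactors 1 serves. *)
Lemma pair_level x y : exists k x' y',
  [/\ (k <= r)%N, x = p ^+ k * x', y = p ^+ k * y' & is_unit x' || is_unit y'].
Proof.
suff H m : (m <= r)%N -> (exists k x' y',
    [/\ (k <= r)%N, x = p ^+ k * x', y = p ^+ k * y' & is_unit x' || is_unit y'])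
  \/ (exists x' y', x = p ^+ m * x' /\ y = p ^+ m * y').
  case: (H r (leqnn r)) => // -[x' [y' [-> ->]]].
  by exists r, 1, 1; rewrite leqnn chain_expr0 !mul0r is_unit1.
elim: m => [|m IH mr]; first by right; exists x, y; rewrite !mul1r.
case: (IH (ltnW mr)) => [|[x' [y' [ex ey]]]]; first by left.
have [un|] := boolP (is_unit x' || is_unit y').
  by left; exists m, x', y'; rewrite ltnW.
rewrite negb_or !is_unitNE => /andP[/dividesP[x'' ex'] /dividesP[y'' ey']].
by right; exists x'', y''; rewrite ex ey ex' ey' !exprSr !mulrA.
Qed.

(** If [k < m] and [p ^+ k * x = p ^+ m * y], then [x - p ^+ (m - k) * y] is killed by [p ^+ k],
    hence divisible by [p ^+ (r - k)], and [p] would divide the unit [x]. *)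
Lemma divides_level1 k m x : (k <= r)%N -> (m <= r)%N -> is_unit x ->
  divides (p ^+ m) (p ^+ k * x) = (m <= k)%N.
Proof.
move=> kr mr ux; apply/idP/idP => [/dividesP[y e]|mk]; last first.
  by apply/dividesP; exists (p ^+ (k - m) * x); rewrite mulrA -exprD subnKC.
rewrite leqNgt; apply/negP => km.
have /eqP : p ^+ k * (x - p ^+ (m - k) * y) = 0.
  by rewrite mulrBr mulrA -exprD subnKC ?e ?subrr // ltnW.
case: (chR) => _ _ -> //; have -> : (r - k = (r - k).-1.+1)%N.
  by rewrite prednK // subn_gt0 (leq_trans km).
move=> /dividesP[z]; rewrite exprS => ez.
move: ux; rewrite is_unitE => /negP; apply.
rewrite -[x](subrK (p ^+ (m - k) * y)) ez; apply: dividesD.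
  by rewrite -mulrA; apply/dividesP; exists (p ^+ (r - k).-1 * z).
apply/dividesP; exists (p ^+ (m - k).-1 * y).
by rewrite mulrA -exprS prednK // subn_gt0.
Qed.

(** Recovers the exponent of [pair_level] from divisibility alone, the only data that a
    congruence-preserving map transports. *)
Lemma divides_level k m x y : (k <= r)%N -> (m <= r)%N ->
    is_unit x || is_unit y ->
  divides (p ^+ m) (p ^+ k * x) && divides (p ^+ m) (p ^+ k * y) = (m <= k)%N.
Proof.
move=> kr mr; have [mk _|km] := leqP m k.
  by rewrite -(subnKC mk) exprD -!mulrA; apply/andP; split; apply/dividesP;
    eexists.
by move=> /orP[] u; rewrite (divides_level1 kr mr u) leqNgt km ?andbF.
Qed.

(** * Vectors, dot product and normalized forms *)

Notation V := 'rV[R]_3.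
Implicit Types (x y a b u v : R) (c d w : V) (i j l : 'I_3).

Definition dot c d := \sum_k c 0 k * d 0 k.
Definition unimodular c := [exists k, is_unit (c 0 k)].
Definition normalized c :=
  [exists j, (c 0 j == 1) && [forall i : 'I_3, (i < j)%N ==> ~~ is_unit (c 0 i)]].

Lemma dotC c d : dot c d = dot d c.
Proof. by apply: eq_bigr => k _; rewrite mulrC. Qed.

Lemma dotZl a c d : dot (a *: c) d = a * dot c d.
Proof. by rewrite /dot mulr_sumr; apply: eq_bigr => k _; rewrite mxE mulrA. Qed.

Lemma dotZr a c d : dot c (a *: d) = a * dot c d.
Proof. by rewrite dotC dotZl dotC. Qed.

Lemma dotDl c c' d : dot (c + c') d = dot c d + dot c' d.
Proof. by rewrite /dot -big_split; apply: eq_bigr => k _; rewrite mxE mulrDl. Qed.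

Lemma dotDr c d d' : dot c (d + d') = dot c d + dot c d'.
Proof. by rewrite dotC dotDl !(dotC c). Qed.

Lemma normalized_unimodular c : normalized c -> unimodular c.
Proof.
by case/existsP=> j /andP[/eqP cj _]; apply/existsP; exists j; rewrite cj is_unit1.
Qed.

Lemma unimodularZ a c : unimodular (a *: c) = is_unit a && unimodular c.
Proof.
apply/existsP/andP => [[k]|[ua /existsP[k uk]]].
  by rewrite mxE is_unitM => /andP[-> uk]; split=> //; apply/existsP; exists k.
by exists k; rewrite mxE is_unitM ua.
Qed.

(** Uniqueness of the normalized form: [a] is a unit because [a *: c] is unimodular, so scaling does
    not move the first unit coordinate, where both vectors have entry 1. *)
Lemma normalizedZ a c : normalized (a *: c) -> normalized c -> a = 1.
Proof.
move=> nac nc; have := normalized_unimodular nac.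
rewrite unimodularZ => /andP[ua _].
case/existsP: nac => j /andP[/eqP aj /forallP hj].
case/existsP: nc => i /andP[/eqP ci /forallP hi].
have ji : (j <= i)%N.
  rewrite leqNgt; apply/negP => ij; have := hj i.
  by rewrite ij mxE ci mulr1 ua.
have ij : (i <= j)%N.
  rewrite leqNgt; apply/negP => ij; have := hi j.
  rewrite ij /= => /negP; apply.
  by have := is_unit1 R; rewrite -aj mxE is_unitM => /andP[].
have e : i = j by apply/val_inj/anti_leq; rewrite ij ji.
by move: aj; rewrite mxE -e ci mulr1.
Qed.

Lemma unimodular_normalize c : unimodular c ->
  exists u d, [/\ is_unit u, normalized d & c = u *: d].
Proof.
case/existsP=> i0 ci0.
case: (arg_minnP (fun k : 'I_3 => k : nat) (P := fun k => is_unit (c 0 k)) ci0).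
move=> j uj minj; case/is_unitP: (uj) => v uv.
exists (c 0 j), (v *: c); split=> //; last first.
  by rewrite scalerA uv scale1r.
apply/existsP; exists j; rewrite mxE mulrC uv eqxx /=.
apply/forallP => i; apply/implyP => ij; rewrite mxE is_unitM negb_and.
by apply/orP; right; apply/negP => /minj; rewrite leqNgt ij.
Qed.

(** Coordinates are addressed through an arbitrary ordering [j, i, l] of ['I_3], so that a unit
    coordinate can come first wherever it stands. *)
Definition row3 (j i : 'I_3) a b e : V :=
  \row_k (if k == j then a else if k == i then b else e).

Lemma ord3_split j i l : uniq [:: j; i; l] ->
  forall k : 'I_3, [\/ k = j, k = i | k = l].
Proof.
move=> u k; have : k \in [:: j; i; l].
  have -> : k \in [:: j; i; l] = (k \in [set: 'I_3]); last by rewrite inE.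
  apply: subset_cardP; first by rewrite cardsT card_ord (card_uniqP u).
  by apply/subsetP => x _; rewrite inE.
by rewrite !inE => /or3P[] /eqP ->; [apply: Or31|apply: Or32|apply: Or33].
Qed.

Lemma ord3_others (j : 'I_3) i : i != j -> exists l, uniq [:: j; i; l].
Proof.
case: j i => [[|[|[|//]]] hj] [[|[|[|//]]] hi] // _;
  by [exists (inord 0); rewrite /= !inE -!val_eqE /= !inordK
    |exists (inord 1); rewrite /= !inE -!val_eqE /= !inordK
    |exists (inord 2); rewrite /= !inE -!val_eqE /= !inordK].
Qed.

Section Coordinates.
Variables j i l : 'I_3.
Hypothesis jil : uniq [:: j; i; l].

Lemma dot3 c d : dot c d = c 0 j * d 0 j + (c 0 i * d 0 i + c 0 l * d 0 l).
Proof.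
move: (ord3_split jil) => H.
move: jil; rewrite /= !inE negb_or => /and3P[/andP[ji jl] il _].
rewrite /dot (bigD1 j) //= (bigD1 i) 1?eq_sym //= (bigD1 l) /=; last first.
  by rewrite ![l == _]eq_sym jl il.
rewrite big1 ?addr0 // => k /andP[/andP[kj ki] kl].
by case: (H k) kj ki kl => ->; rewrite eqxx.
Qed.

Lemma row3E a b e : [/\ row3 j i a b e 0 j = a, row3 j i a b e 0 i = b
  & row3 j i a b e 0 l = e].
Proof.
move: jil; rewrite /= !inE negb_or => /and3P[/andP[ji jl] il _].
by rewrite !mxE !eqxx ![_ == j]eq_sym (negPf ji) (negPf jl) [l == i]eq_sym (negPf il).
Qed.

Lemma row3_ext c d : c 0 j = d 0 j -> c 0 i = d 0 i -> c 0 l = d 0 l -> c = d.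
Proof.
by move=> ej ei el; apply/rowP => k; case: (ord3_split jil k) => ->.
Qed.

Lemma unimodular3 c :
  unimodular c = [|| is_unit (c 0 j), is_unit (c 0 i) | is_unit (c 0 l)].
Proof.
apply/existsP/or3P => [[k]|[] u]; last first.
- by exists l.
- by exists i.
- by exists j.
by case: (ord3_split jil k) => -> u; [apply: Or31|apply: Or32|apply: Or33].
Qed.

End Coordinates.

(** * Counting the lines through two points *)

Definition common_zeros (P : pred V) c c' :=
  [set d | [&& P d, dot c d == 0 & dot c' d == 0]].
(** The common zeros of two vectors in adapted coordinates: only the level [k] of the two vectors is
    left. *)
Definition annihilator_pairs k := [set ab : R * R |
  (is_unit (ab.1 : R) || is_unit (ab.2 : R)) && (p ^+ k * ab.1 == 0)].
Definition congruent m c c' := [forall k, divides (p ^+ m) (c' 0 k - c 0 k)].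

Lemma nonunitD x y : ~~ is_unit x -> ~~ is_unit y -> ~~ is_unit (x + y).
Proof. by rewrite !is_unitNE; apply: dividesD. Qed.

Lemma nonunitM x y : ~~ is_unit y -> ~~ is_unit (x * y).
Proof. by rewrite !is_unitNE; apply: dividesMl. Qed.

(** A zero [d] of [c] is determined by its coordinates [i] and [l]. The invertible substitution
    [a = x * d 0 i + y * d 0 l], [b = d 0 l] turns [dot w d] into [p ^+ k * a]. Since [d 0 j] is a
    combination of the other two coordinates, [d] is unimodular exactly when [(a, b)] is. *)
Lemma card_common_zeros_scaled j i l c w k x y : uniq [:: j; i; l] ->
  c 0 j = 1 -> w 0 j = 0 -> w 0 i = p ^+ k * x -> w 0 l = p ^+ k * y ->
  is_unit x -> #|common_zeros unimodular c w| = #|annihilator_pairs k|.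
Proof.
move=> jil cj wj wi wl /is_unitP[v xv].
(* Inverse substitution: [di] solves [x * di + y * ab.2 = ab.1], and coordinate [j] is then forced
   by [dot c d = 0]. *)
pose g (ab : R * R) := let di := v * (ab.1 - y * ab.2) in
  row3 j i (- (c 0 i * di + c 0 l * ab.2)) di ab.2.
have gE ab : [/\ g ab 0 j = - (c 0 i * g ab 0 i + c 0 l * ab.2),
    g ab 0 i = v * (ab.1 - y * ab.2) & g ab 0 l = ab.2].
  rewrite /g; set di := v * _; set dj := - _.
  by have [-> -> ->] := row3E jil dj di ab.2.
have gK d : dot c d = 0 -> g (x * d 0 i + y * d 0 l, d 0 l) = d.
  rewrite (dot3 jil) cj mul1r => /eqP; rewrite addr_eq0 => /eqP dj.
  have di : v * (x * d 0 i + y * d 0 l - y * d 0 l) = d 0 i.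
    by rewrite addrK mulrA [v * x]mulrC xv mul1r.
  have [] := gE (x * d 0 i + y * d 0 l, d 0 l); rewrite /= di => ej ei el.
  by apply: (row3_ext jil); rewrite ?ej ?ei ?el // dj.
have gx ab : x * g ab 0 i + y * ab.2 = ab.1.
  by case: (gE ab) => _ -> _; rewrite mulrA xv mul1r subrK.
have gI : injective g.
  move=> ab ab' e; have e2 : ab.2 = ab'.2.
    by case: (gE ab) => _ _ <-; case: (gE ab') => _ _ <-; rewrite e.
  have e1 : ab.1 = ab'.1 by rewrite -(gx ab) -(gx ab') e e2.
  by case: ab ab' e1 e2 {e} => a b [a' b'] /= -> ->.
have cg ab : dot c (g ab) = 0.
  rewrite (dot3 jil) cj; case: (gE ab) => -> _ ->; ring.
have wg ab : dot w (g ab) = p ^+ k * ab.1.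
  rewrite (dot3 jil) wj wi wl -[in RHS](gx ab); case: (gE ab) => _ _ ->; ring.
have ug ab : unimodular (g ab) = is_unit ab.1 || is_unit ab.2.
  rewrite (unimodular3 jil); case: (gE ab) => -> _ ->.
  apply/idP/idP; last first.
    move=> /orP[u|->]; last by rewrite !orbT.
    apply/negPn/negP; rewrite !negb_or => /and3P[_ ni nl].
    have := nonunitD (nonunitM x ni) (nonunitM y nl).
    by rewrite gx u.
  apply: contraTT; rewrite !negb_or => /andP[n1 n2].
  have ni : ~~ is_unit (g ab 0 i).
    by case: (gE ab) => _ -> _; rewrite -mulNr nonunitM // nonunitD // nonunitM.
  by rewrite ni n2 -mulN1r !nonunitM // nonunitD // nonunitM.
rewrite -(card_imset _ gI); apply: eq_card => d; rewrite inE.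
apply/and3P/imsetP => [[ud /eqP cd /eqP wd]|[ab]].
  exists (x * d 0 i + y * d 0 l, d 0 l); last by rewrite gK.
  by rewrite inE -ug -wg gK // ud wd eqxx.
by rewrite inE -ug -wg => /andP[uab wab] ->; rewrite cg eqxx.
Qed.

(** Replacing [c'] by [w], its reduction by [c] at the coordinate [j] where [c] is 1, keeps the
    common zeros; [k] is the exponent of the common power of [p] in the two other coordinates of
    [w]. *)
Lemma card_common_zeros c c' : normalized c -> normalized c' ->
  exists k, [/\ (k <= r)%N,
    forall m, (m <= r)%N -> congruent m c c' = (m <= k)%N
    & #|common_zeros unimodular c c'| = #|annihilator_pairs k|].
Proof.
move=> nc nc'.
case/existsP: (nc) => j /andP[/eqP cj /forallP hj].
pose w := c' - c' 0 j *: c.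
have wj : w 0 j = 0 by rewrite !mxE cj mulr1 subrr.
have c'E k : c' 0 k = w 0 k + c' 0 j * c 0 k by rewrite !mxE subrK.
have [i ij] : exists i : 'I_3, i != j.
  by exists (lift j 0); rewrite eq_sym neq_lift.
have [l jil] := ord3_others ij.
have [k [x [y [kr wi wl uxy]]]] := pair_level (w 0 i) (w 0 l).
have Sw : common_zeros unimodular c c' = common_zeros unimodular c w.
  apply/setP => d; rewrite !inE; case: eqP => [cd|]; last by rewrite !andbF.
  by rewrite /w -scaleN1r dotDl dotZl dotZl cd !mulr0 addr0.
have cong m : (m <= r)%N -> congruent m c c' = (m <= k)%N.
  move=> mr; rewrite -(divides_level kr mr uxy) -wi -wl.
  apply/forallP/andP => [H|[Hi Hl]].
    have Hw t : divides (p ^+ m) (w 0 t).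
      have -> : w 0 t = (c' 0 t - c 0 t) + (- c 0 t) * (c' 0 j - c 0 j).
        by rewrite !mxE cj; ring.
      by apply: dividesD => //; apply: dividesMl.
    by split.
  (* For a positive exponent, [p] divides [w], so [c'] is [c' 0 j *: c] modulo [p]. The first unit
     coordinates of [c] and [c'] then coincide, hence [c' 0 j = 1] and [w = c' - c]. *)
  case: m mr Hi Hl => [|m] mr Hi Hl t; first exact: divides1.
  have Hw s : divides (p ^+ m.+1) (w 0 s).
    by case: (ord3_split jil s) => -> //; rewrite wj divides0.
  have Hp s : ~~ is_unit (w 0 s).
    rewrite is_unitNE; case/dividesP: (Hw s) => z ->.
    by apply/dividesP; exists (p ^+ m * z); rewrite exprS mulrA.
  have uj : is_unit (c' 0 j).
    have := normalized_unimodular nc'; case/existsP=> s; apply: contraLR => nu.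
    by rewrite c'E nonunitD // mulrC nonunitM.
  case/existsP: (nc') => j' /andP[/eqP cj' /forallP hj'].
  have jj' : j = j'.
    case: (ltngtP j j') => [lt|lt|/val_inj //].
      by have := hj' j; rewrite lt uj.
    have := hj j'; rewrite lt /= => nu.
    have : ~~ is_unit (c' 0 j') by rewrite c'E nonunitD // nonunitM.
    by rewrite cj' is_unit1.
  by have := Hw t; rewrite !mxE {1}jj' cj' mul1r.
exists k; split=> //; rewrite Sw.
case/orP: uxy => u.
  exact: (card_common_zeros_scaled jil cj wj wi wl u).
have jli : uniq [:: j; l; i].
  by move: jil; rewrite /= !inE !negb_or ![l == i]eq_sym =>
    /and3P[/andP[-> ->] ->].
exact: (card_common_zeros_scaled jli cj wj wl wi u).
Qed.

(** A unimodular vector is uniquely a unit times a normalized one. Unimodular vectors suit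
    coordinate changes, normalized ones index the lines. *)
Lemma card_common_zeros_unimodular c c' :
  #|common_zeros unimodular c c'| =
  (#|[set u | @is_unit R u]| * #|common_zeros normalized c c'|)%N.
Proof.
rewrite -cardsX -(card_in_imset (f := fun ud : R * V => ud.1 *: ud.2)).
  apply: eq_card => d; rewrite inE; apply/and3P/imsetP => [[ud cd cd']|].
    have [u [e [uu ne de]]] := unimodular_normalize ud.
    exists (u, e) => //; rewrite !inE uu ne /=.
    case/is_unitP: uu => v uv.
    have -> : e = v *: d by rewrite de scalerA mulrC uv scale1r.
    by rewrite !dotZr (eqP cd) (eqP cd') mulr0 eqxx.
  case=> -[u e]; rewrite !inE /= => /andP[uu /and3P[ne /eqP ce /eqP c'e]] ->.
  by rewrite unimodularZ uu normalized_unimodular // !dotZr ce c'e mulr0.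
move=> [u d] [u' d'] /=; rewrite !inE /=.
move=> /andP[/is_unitP[v uv] /and3P[nd _ _]] /andP[_ /and3P[nd' _ _]] e.
have de : d = (v * u') *: d' by rewrite -scalerA -e scalerA mulrC uv scale1r.
have vu : v * u' = 1 by apply: (normalizedZ _ nd'); rewrite -de.
by rewrite de vu scale1r -[u]mulr1 -vu mulrA uv mul1r.
Qed.

(** * Vertices of the free plane as points and lines *)

Definition point c : {set V} := [set a *: c | a : R].
Definition line c : {set V} := [set d | dot c d == 0].

Lemma unimodularZI c : unimodular c -> injective (fun a => a *: c).
Proof.
case/existsP=> k /is_unitP[v cv] a b /rowP/(_ k); rewrite !mxE => e.
by rewrite -[a]mulr1 -[b]mulr1 -cv !mulrA e.
Qed.

Lemma card_point c : unimodular c -> #|point c| = #|R|.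
Proof. by move/unimodularZI => cI; rewrite /point card_imset. Qed.

Lemma pointZ u c : is_unit u -> point (u *: c) = point c.
Proof.
case/is_unitP=> v uv; apply/setP=> d; apply/imsetP/imsetP => -[a _ ->].
  by exists (a * u); rewrite // scalerA.
by exists (a * v); rewrite // scalerA -mulrA [v * u]mulrC uv mulr1.
Qed.

Lemma lineZ u c : is_unit u -> line (u *: c) = line c.
Proof.
case/is_unitP=> v uv; apply/setP=> d; rewrite !inE dotZl.
apply/eqP/eqP => [|->]; last by rewrite mulr0.
by move/(congr1 ( *%R v)); rewrite mulr0 mulrA [v * u]mulrC uv mul1r.
Qed.

Section LineCoordinates.
Variables (j i l : 'I_3) (c : V).
Hypotheses (jil : uniq [:: j; i; l]) (cj : c 0 j = 1).

(** As [c 0 j = 1], the line is the graph of coordinate [j] over coordinates [i] and [l]. *)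
Definition line_param a b := row3 j i (- (c 0 i * a + c 0 l * b)) a b.

Lemma line_paramE a b : [/\ line_param a b 0 j = - (c 0 i * a + c 0 l * b),
  line_param a b 0 i = a & line_param a b 0 l = b].
Proof. exact: row3E. Qed.

Lemma line_param_inj a b a' b' :
  line_param a b = line_param a' b' -> a = a' /\ b = b'.
Proof.
move=> e; have [_ ei el] := line_paramE a b.
by have [_ ei' el'] := line_paramE a' b'; split;
  [rewrite -[LHS]ei e | rewrite -[LHS]el e].
Qed.

Lemma mem_line_param a b : line_param a b \in line c.
Proof.
by rewrite inE (dot3 jil) cj; case: (line_paramE a b) => -> -> ->; apply/eqP; ring.
Qed.

Lemma line_paramK d : d \in line c -> line_param (d 0 i) (d 0 l) = d.
Proof.
rewrite inE (dot3 jil) cj mul1r addr_eq0 => /eqP dj.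
have [ej ei el] := line_paramE (d 0 i) (d 0 l).
by apply: (row3_ext jil); rewrite ?ej ?ei ?el.
Qed.
End LineCoordinates.

Lemma normalized_coord c : normalized c ->
  exists j i l, uniq [:: j; i; l] /\ c 0 j = 1.
Proof.
case/existsP=> j /andP[/eqP cj _].
have [l jil] : exists l, uniq [:: j; lift j 0; l].
  by apply: ord3_others; rewrite eq_sym neq_lift.
by exists j, (lift j 0), l.
Qed.

Lemma card_line c : normalized c -> #|line c| = (#|R| ^ 2)%N.
Proof.
move=> /normalized_coord[j [i [l [jil cj]]]].
pose g (ab : R * R) := line_param j i l c ab.1 ab.2.
have gI : injective g.
  by move=> [a b] [a' b'] /(line_param_inj jil) /= [-> ->].
have -> : line c = [set g ab | ab : R * R].
  apply/setP => d; apply/idP/imsetP => [dc|[ab _ ->]].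
    by exists (d 0 i, d 0 l); rewrite // /g line_paramK.
  exact: mem_line_param.
by rewrite card_imset // card_prod mulnn.
Qed.

Lemma card_row3 : #|[set: V]| = (#|R| ^ 3)%N.
Proof. by rewrite cardsT card_mx. Qed.

Lemma free_module1 c : unimodular c -> is_free_module (point c).
Proof.
move=> /unimodularZI cI; exists 1%N, c.
have mE (a : 'rV[R]_1) : a *m c = a 0 0 *: c.
  by rewrite [a in LHS]mx11_scalar mul_scalar_mx.
split=> [a b|]; first by rewrite !mE => /cI e; rewrite [a]mx11_scalar e -mx11_scalar.
apply/setP => d; apply/imsetP/imsetP => -[a _ ->].
  by exists a%:M; rewrite // mE mxE mulr1n.
by exists (a 0 0); rewrite // mE.
Qed.

Lemma free_module2 c : normalized c -> is_free_module (line c).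
Proof.
move=> /normalized_coord[j [i [l [jil cj]]]].
pose L := line_param j i l c.
pose B : 'M[R]_(2, 3) := \matrix_(t, k) (if t == 0 then L 1 0 else L 0 1) 0 k.
have mE (a : 'rV[R]_2) : a *m B = L (a 0 0) (a 0 1).
  have E k : (a *m B) 0 k = a 0 0 * L 1 0 0 k + a 0 1 * L 0 1 0 k.
    rewrite mxE !big_ord_recl big_ord0 addr0 !mxE /=.
    by congr (_ + a _ _ * _); apply: val_inj.
  have [uj ui ul] := line_paramE c jil 1 0.
  have [vj vi vl] := line_paramE c jil 0 1.
  have [wj wi wl] := line_paramE c jil (a 0 0) (a 0 1).
  apply: (row3_ext jil); rewrite E /L ?uj ?ui ?ul ?vj ?vi ?vl ?wj ?wi ?wl; ring.
exists 2%N, B; split=> [a b|].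
  rewrite !mE => /(line_param_inj jil)[e0 e1]; apply/rowP => t.
  by case: t => [[|[|//]] ht]; [move: e0 | move: e1];
    congr (_ = _); congr (_ _ _); apply: val_inj.
apply/setP => d; apply/idP/imsetP => [dc|[a _ ->]]; last first.
  by rewrite mE mem_line_param.
exists (\row_t if t == 0 then d 0 i else d 0 l) => //.
by rewrite mE !mxE /= /L line_paramK.
Qed.

Lemma point_vertex c : normalized c ->
  [&& `[< free_submodule (point c) >], [set 0] \proper point c
    & point c \proper [set: V]].
Proof.
move=> /normalized_unimodular uc; have R1 : (1 < #|R|)%N := finNzRing_gt1 R.
have sub : submod_closed (point c).
  split=> [|a u v /imsetP[b _ ->] /imsetP[e _ ->]]; apply/imsetP.
    by exists 0; rewrite // scale0r.
  by exists (a * b + e); rewrite // scalerDl scalerA.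
apply/and3P; split.
- by apply/asboolP; split=> //; apply: free_module1.
- by rewrite properEcard sub1set (proj1 sub) cards1 card_point.
- rewrite properEcard subsetT card_point // card_row3.
  by rewrite -[X in (X < _)%N]expn1 ltn_exp2l.
Qed.

Lemma line_vertex c : normalized c ->
  [&& `[< free_submodule (line c) >], [set 0] \proper line c
    & line c \proper [set: V]].
Proof.
move=> nc; have R1 : (1 < #|R|)%N := finNzRing_gt1 R.
have d0 : dot c 0 = 0 by rewrite /dot big1 // => k _; rewrite mxE mulr0.
have sub : submod_closed (line c).
  split=> [|a u v]; rewrite !inE ?d0 //.
  by rewrite dotDr dotZr => /eqP -> /eqP ->; rewrite mulr0 addr0.
apply/and3P; split.
- by apply/asboolP; split=> //; apply: free_module2.
- rewrite properEcard sub1set (proj1 sub) cards1 card_line //.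
  by rewrite -[1%N](expn0 #|R|) ltn_exp2l.
- by rewrite properEcard subsetT card_line // card_row3 ltn_exp2l.
Qed.

(** If no coordinate of [a *m B] were a unit, [p ^+ r.-1] would kill it. Injectivity would then give
    [p ^+ r.-1 *: a = 0], which fails at coordinate [t]. *)
Lemma injective_unimodular n (B : 'M[R]_(n, 3)) (a : 'rV[R]_n) t :
  injective (fun e : 'rV[R]_n => e *m B) -> a 0 t = 1 -> unimodular (a *m B).
Proof.
move=> BI at1; apply: contraT => nu.
have /BI/rowP/(_ t)/eqP : (p ^+ r.-1 *: a) *m B = 0 *m B.
  rewrite mul0mx -scalemxAl; apply/rowP => k; rewrite mxE [RHS]mxE.
  apply/eqP; rewrite socle_eq0; apply: contra nu => uk.
  by apply/existsP; exists k.
by rewrite !mxE at1 mulr1 (negPf socle_neq0).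
Qed.

(** Gaussian elimination: [injective_unimodular] supplies a unit pivot [j] in the first row, and
    another one [i] in the second row once its entry at [j] is cleared. *)
Lemma free_rank2_orthogonal (B : 'M[R]_(2, 3)) :
  injective (fun e : 'rV[R]_2 => e *m B) ->
  exists c, normalized c /\ forall e : 'rV[R]_2, dot c (e *m B) = 0.
Proof.
move=> BI; pose e0 : 'rV[R]_2 := delta_mx 0 0; pose e1 : 'rV[R]_2 := delta_mx 0 1.
pose b := e0 *m B.
have /existsP[j /is_unitP[v bv]] : unimodular b.
  by apply: (injective_unimodular (t := 0)) => //; rewrite mxE.
pose x := (e1 *m B) 0 j * v; pose b' := (e1 - x *: e0) *m B.
have b'j : b' 0 j = 0.
  have sub w : (w - x *: b) 0 j = w 0 j - x * b 0 j by rewrite !mxE.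
  by rewrite /b' mulmxBl -scalemxAl sub -mulrA [v * _]mulrC bv mulr1 subrr.
have /existsP[i ui] : unimodular b'.
  by apply: (injective_unimodular (t := 1)) => //; rewrite !mxE mulr0 subr0.
have ij : i != j.
  apply/eqP => e; have := ui.
  by rewrite e b'j => /is_unitP[y]; rewrite mul0r => /esym/eqP; rewrite oner_eq0.
case/is_unitP: ui => v' bv'.
have [l jil] := ord3_others ij.
(* Back substitution from [c 0 l = 1], which also makes [c] unimodular: [ci] solves [dot c b' = 0],
   then [cj] solves [dot c b = 0]. *)
pose ci := - (b' 0 l * v'); pose cj := - ((b 0 i * ci + b 0 l) * v).
pose c := row3 j i cj ci 1.
have [Ej Ei El] := row3E jil cj ci 1.
have cb : dot c b = 0.
  rewrite (dot3 jil) Ej Ei El.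
  have -> : cj * b 0 j = - ((b 0 i * ci + b 0 l) * (b 0 j * v)) by rewrite /cj; ring.
  rewrite bv; ring.
have cb' : dot c b' = 0.
  rewrite (dot3 jil) Ej Ei El b'j.
  have -> : ci * b' 0 i = - (b' 0 l * (b' 0 i * v')) by rewrite /ci; ring.
  rewrite bv'; ring.
have uc : unimodular c by rewrite (unimodular3 jil) El is_unit1 !orbT.
have [u [d [uu nd cd]]] := unimodular_normalize uc.
exists d; split=> // e.
have -> : e *m B = (e 0 0 + e 0 1 * x) *: b + e 0 1 *: b'.
  rewrite /b /b' !scalemxAl -mulmxDl; congr (_ *m B); apply/rowP => t.
  by case: t => [[|[|//]] ht]; rewrite !mxE /=;
    (have -> : Ordinal ht = 0 by apply: val_inj)
    || (have -> : Ordinal ht = 1 by apply: val_inj); rewrite /=; ring.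
have : (e 0 0 + e 0 1 * x) *: b + e 0 1 *: b' \in line c.
  by rewrite inE dotDr !dotZr cb cb' !mulr0 addr0 eqxx.
by rewrite cd lineZ // inE => /eqP.
Qed.

(** Cardinality bounds the rank: [M] has [#|R| ^ n] elements, so [n] is 1 or 2. In rank 1 the
    generator is unimodular; in rank 2, [M] lies in a line with the same number of elements. *)
Lemma vertex_cases (M : free_plane_vertex R) :
  (exists2 c, normalized c & fp_module M = point c) \/
  (exists2 c, normalized c & fp_module M = line c).
Proof.
case: M => M /= /and3P[/asboolP[_ [n [B [BI EM]]]] M0 MT].
have cM : #|M| = (#|R| ^ n)%N by rewrite EM card_imset // card_mx mul1n.
have n3 : (n < 3)%N.
  by rewrite -(ltn_exp2l _ _ (finNzRing_gt1 R)) -cM -card_row3 proper_card.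
case: n B BI EM cM n3 => [|[|[|//]]] B BI EM cM _.
- have := proper_card M0; rewrite cM expn0.
  by rewrite cards1.
- left; have uB : unimodular B.
    by rewrite -[B]mul1mx; apply: (injective_unimodular (t := 0)) => //; rewrite mxE.
  have [u [d [uu nd eB]]] := unimodular_normalize uB.
  exists d; rewrite // -(pointZ d uu) -eB EM.
  have mE (a : 'rV[R]_1) : a *m B = a 0 0 *: B.
    by rewrite [a in LHS]mx11_scalar mul_scalar_mx.
  apply/setP => w; apply/imsetP/imsetP => -[a _ ->].
    by exists (a 0 0); rewrite // mE.
  by exists a%:M; rewrite // mE mxE mulr1n.
- right; have [c [nc cB]] := free_rank2_orthogonal BI.
  exists c => //; apply/eqP; rewrite eqEcard card_line // cM leqnn andbT.
  by apply/subsetP => w; rewrite EM inE => /imsetP[a _ ->]; rewrite cB.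
Qed.

Lemma point_subset c d : normalized c -> normalized d ->
  (point c \subset point d) = (c == d).
Proof.
move=> nc nd; apply/idP/eqP => [/subsetP/(_ c)|-> //].
have -> : c \in point c by apply/imsetP; exists 1; rewrite ?scale1r.
move=> /(_ isT)/imsetP[a _ e].
have a1 : a = 1 by apply: (normalizedZ _ nd); rewrite -e.
by rewrite e a1 scale1r.
Qed.

(** Testing [d] on the vectors of the line with parameters [(1, 0)] and [(0, 1)] shows that [d] is a
    multiple of [c]. *)
Lemma line_subset c d : normalized c -> normalized d ->
  (line c \subset line d) = (c == d).
Proof.
move=> nc nd; apply/idP/eqP => [/subsetP H|-> //].
have [j [i [l [jil cj]]]] := normalized_coord nc.
have H' a b : d 0 j * - (c 0 i * a + c 0 l * b) + (d 0 i * a + d 0 l * b) = 0.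
  have := H _ (mem_line_param jil cj a b).
  rewrite inE (dot3 jil).
  by have [-> -> ->] := line_paramE c jil a b => /eqP.
have e : d = d 0 j *: c.
  apply: (row3_ext jil); rewrite mxE ?cj ?mulr1 //.
    by apply/subr0_eq; rewrite -(H' 1 0); ring.
  by apply/subr0_eq; rewrite -(H' 0 1); ring.
have d1 : d 0 j = 1 by apply: (normalizedZ _ nc); rewrite -e.
by rewrite e d1 scale1r.
Qed.

Lemma point_subset_line c d : (point c \subset line d) = (dot c d == 0).
Proof.
apply/subsetP/eqP => [/(_ c)|cd _ /imsetP[a _ ->]].
  have -> : c \in point c by apply/imsetP; exists 1; rewrite ?scale1r.
  by move=> /(_ isT); rewrite inE dotC => /eqP.
by rewrite inE dotZr dotC cd mulr0.
Qed.

Lemma line_subset_point c d : normalized c -> normalized d ->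
  (line c \subset point d) = false.
Proof.
move=> nc nd; apply/negP => /subset_leq_card.
rewrite card_line // card_point ?normalized_unimodular //.
by rewrite -[X in (_ <= X)%N]expn1 leq_exp2l // (finNzRing_gt1 R).
Qed.

(** * The adjacency matrix of the free plane *)

Definition coords := {c : V | normalized c}.

Definition coords_vertex (t : coords + coords) : free_plane R :=
  match t with
  | inl c => FreePlaneVertex (point_vertex (valP c))
  | inr c => FreePlaneVertex (line_vertex (valP c))
  end.

Lemma coords_vertex_inj : injective coords_vertex.
Proof.
move=> [[c nc]|[c nc]] [[d nd]|[d nd]].
all: move=> /(congr1 (fun M : free_plane_vertex R => fp_module M)) /= e.
- by congr inl; apply/val_inj/eqP; rewrite /= -point_subset // e.
- by have := line_subset_point nd nc; rewrite e subxx.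
- by have := line_subset_point nc nd; rewrite e subxx.
- by congr inr; apply/val_inj/eqP; rewrite /= -line_subset // e.
Qed.

Lemma coords_vertex_surj (M : free_plane R) : exists t, coords_vertex t = M.
Proof.
case: (vertex_cases M) => -[c nc EM].
  by exists (inl (Sub c nc)); apply: val_inj.
by exists (inr (Sub c nc)); apply: val_inj.
Qed.

(** Two points, or two lines, are comparable only when equal, so the graph is bipartite. *)
Lemma coords_vertex_adj s t : adj (coords_vertex s) (coords_vertex t) =
  match s, t with
  | inl c, inr d | inr c, inl d => dot (val c) (val d) == 0
  | _, _ => false
  end.
Proof.
rewrite /adj /= /fp_adj (inj_eq coords_vertex_inj).
case: s t => [c|c] [d|d] /=.
- rewrite !point_subset ?(valP c) ?(valP d) // [val d == _]eq_sym orbb.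
  by rewrite (inj_eq val_inj) (inj_eq (fun _ _ => @inl_inj _ _ _ _)) andNb.
- by rewrite point_subset_line line_subset_point ?(valP c) ?(valP d) ?orbF.
- by rewrite point_subset_line line_subset_point ?(valP c) ?(valP d) // dotC.
- rewrite !line_subset ?(valP c) ?(valP d) // [val d == _]eq_sym orbb.
  by rewrite (inj_eq val_inj) (inj_eq (fun _ _ => @inr_inj _ _ _ _)) andNb.
Qed.

Definition orthogonality_mx : 'M[algC]_#|{: coords}| :=
  \matrix_(s, t) (dot (val (enum_val s)) (val (enum_val t)) == 0)%:R.

Lemma orthogonality_mx_sqr s t : (orthogonality_mx *m orthogonality_mx) s t =
  #|common_zeros normalized (val (enum_val s)) (val (enum_val t))|%:R.
Proof.
set c := val (enum_val s); set c' := val (enum_val t).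
pose b (x : coords) := (dot c (val x) == 0) && (dot c' (val x) == 0).
transitivity (\sum_(x : coords) (b x)%:R : algC).
  rewrite mxE (reindex_onto (@enum_rank _) enum_val) /=; last first.
    by move=> i _; rewrite enum_valK.
  apply: eq_big => [x|x _]; first by rewrite enum_rankK eqxx.
  by rewrite !mxE enum_rankK [dot _ c']dotC -natrM mulnb.
rewrite -natr_sum -big_mkcond sum1_card; congr (_%:R).
rewrite -(card_image val_inj); apply: eq_card => d; rewrite inE.
apply/imageP/and3P => [[x bx ->]|[nd cd c'd]].
  by have /andP[cx c'x] : b x := bx; split=> //; apply: valP.
by exists (Sub d nd); rewrite // unfold_in /b /= cd.
Qed.

Lemma free_plane_char_poly :
  char_poly (adj_mx (free_plane R)) =
  char_poly (orthogonality_mx *m orthogonality_mx) \Po 'X^2.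
Proof.
(* All points are listed first, then all lines in the same order; the adjacency matrix becomes block
   antidiagonal. *)
pose h (k : 'I_(#|{: coords}| + #|{: coords}|)) := enum_rank (coords_vertex
  match split k with inl s => inl (enum_val s) | inr s => inr (enum_val s) end).
have hI : injective h.
  move=> k k' /enum_rank_inj/coords_vertex_inj e; apply: (can_inj splitK).
  by case: (split k) (split k') e => s [] s' // [/enum_val_inj ->].
have hS k : exists k', h k' = k.
  have [t Et] := coords_vertex_surj (enum_val k).
  exists (unsplit match t with
    inl c => inl (enum_rank c) | inr c => inr (enum_rank c) end).
  rewrite /h unsplitK -[k]enum_valK -Et; congr (enum_rank (coords_vertex _)).
  by case: t {Et} => c; rewrite enum_rankK.
rewrite -(char_poly_mxsub _ (injective_surjective_bij hI hS)) -char_poly_antidiag.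
congr char_poly; apply/matrixP => k k'.
rewrite !mxE !enum_rankK coords_vertex_adj.
by case: (split k) => s; rewrite !mxE; case: (split k') => t; rewrite !mxE.
Qed.
End ChainRing.

(** * Comparison of two chain rings *)

Section Transfer.
Variables (R R' : finComNzRingType) (p : R) (p' : R') (r : nat).
Hypotheses (chR : chain_ring p r) (chR' : chain_ring p' r).

(** A condition on maps of sets, since the two rings may fail to be isomorphic, as with the integers
    modulo a prime power and truncated polynomials over the prime field. *)
Definition preserves_congruences (f : R -> R') :=
  forall m x y, (m <= r)%N ->
    divides (p ^+ m) (x - y) = divides (p' ^+ m) (f x - f y).

(** As 1 and 0 are incongruent modulo [p], [f 1 - f 0] is a unit, so [f] can be translated and
    rescaled. *)
Lemma preserves_congruences_normalize (f : R -> R') :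
    bijective f -> preserves_congruences f ->
  exists g, [/\ bijective g, preserves_congruences g, g 0 = 0 & g 1 = 1].
Proof.
move=> fB fC; have [r0 _ _] := chR.
have : is_unit (f 1 - f 0).
  rewrite (is_unitE chR') -[p']expr1 -fC // expr1 subr0 -(is_unitE chR).
  exact: is_unit1.
case/is_unitP=> v fv.
have vu : is_unit v by apply/is_unitP; exists (f 1 - f 0); rewrite mulrC.
exists (fun x => v * (f x - f 0)); split.
- have vI : injective (fun y : R' => v * (y - f 0)).
    move=> y z /(congr1 ( *%R (f 1 - f 0))); rewrite !mulrA fv !mul1r.
    exact: addIr.
  exact: (bij_comp (injF_bij vI) fB).
- move=> m x y mr; rewrite -mulrBr dividesMunit // fC //.
  by congr divides; ring.
- by rewrite subrr mulr0.
- by rewrite mulrC.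
Qed.

Section Map.
Variable f : R -> R'.
Hypotheses (fB : bijective f) (fC : preserves_congruences f).
Hypotheses (f0 : f 0 = 0) (f1 : f 1 = 1).

Lemma is_unit_map x : is_unit (f x) = is_unit x.
Proof.
have [r0 _ _] := chR; rewrite (is_unitE chR) (is_unitE chR').
by rewrite -[p]expr1 -[x in RHS]subr0 fC // f0 subr0 expr1.
Qed.

Lemma card_units_map : #|[set u | @is_unit R u]| = #|[set u | @is_unit R' u]|.
Proof.
rewrite -(card_imset _ (bij_inj fB)); apply: eq_card => u.
rewrite inE; apply/imsetP/idP => [[x ux ->]|uu].
  by rewrite is_unit_map; rewrite inE in ux.
by case: fB => g fK gK; exists (g u); rewrite ?gK // inE -is_unit_map gK.
Qed.

Lemma card_annihilator_pairs_map k : (k <= r)%N ->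
  #|annihilator_pairs p k| = #|annihilator_pairs p' k|.
Proof.
move=> kr; have [_ _ HR] := chR; have [_ _ HR'] := chR'.
(* Being killed by [p ^+ k] is congruence to 0 modulo [p ^+ (r - k)]. *)
have annE a : (p' ^+ k * f a == 0) = (p ^+ k * a == 0).
  by rewrite HR // HR' // -[a in RHS]subr0 fC ?leq_subr // f0 subr0.
pose F (ab : R * R) := (f ab.1, f ab.2).
have FI : injective F by move=> [a b] [a' b'] [/(bij_inj fB) -> /(bij_inj fB) ->].
rewrite -(card_imset _ FI); apply: eq_card => -[a b].
rewrite inE; apply/imsetP/idP => [[[x y]]|/= H].
  by rewrite inE /= => H [-> ->]; rewrite !is_unit_map annE.
case: fB => g fK gK; exists (g a, g b); last by rewrite /F /= !gK.
by rewrite inE /= -!is_unit_map -annE !gK.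
Qed.

Lemma normalized_map (c : 'rV[R]_3) : normalized (map_mx f c) = normalized c.
Proof.
apply: eq_existsb => j; rewrite mxE -f1 (inj_eq (bij_inj fB)); congr (_ && _).
by apply: eq_forallb => i; rewrite mxE is_unit_map.
Qed.

Lemma congruent_map m (c c' : 'rV[R]_3) : (m <= r)%N ->
  congruent p' m (map_mx f c) (map_mx f c') = congruent p m c c'.
Proof. by move=> mr; apply: eq_forallb => k; rewrite !mxE -fC. Qed.

(** [map_mx f] need not send common zeros to common zeros. The counts agree because, up to the
    number of units, each is a function of the largest exponent of a congruence between the two
    vectors, which [f] preserves. *)
Lemma card_common_zeros_map (c c' : 'rV[R]_3) : normalized c -> normalized c' ->
  #|common_zeros (@normalized R) c c'| =
  #|common_zeros (@normalized R') (map_mx f c) (map_mx f c')|.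
Proof.
move=> nc nc'.
have [k [kr kC kE]] := card_common_zeros chR nc nc'.
have [|| k' [kr' kC' kE']] :=
  @card_common_zeros _ _ _ chR' (map_mx f c) (map_mx f c').
- by rewrite normalized_map.
- by rewrite normalized_map.
have kk : k = k'.
  apply/anti_leq; rewrite -kC' // congruent_map // kC // leqnn /=.
  by rewrite -kC // -congruent_map // kC'.
have units_gt0 : (0 < #|[set u | @is_unit R u]|)%N.
  by apply/card_gt0P; exists 1; rewrite inE is_unit1.
apply/eqP; rewrite -(eqn_pmul2l units_gt0) -card_common_zeros_unimodular.
rewrite card_units_map -card_common_zeros_unimodular kE kE' -kk.
by rewrite card_annihilator_pairs_map.
Qed.

Lemma orthogonality_char_poly_map :
  char_poly (orthogonality_mx R *m orthogonality_mx R) =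
  char_poly (orthogonality_mx R' *m orthogonality_mx R').
Proof.
have nF (c : coords R) : normalized (map_mx f (val c)).
  by rewrite normalized_map; apply: valP.
pose F (c : coords R) : coords R' := Sub (map_mx f (val c)) (nF c).
pose h (s : 'I_#|{: coords R}|) : 'I_#|{: coords R'}| :=
  enum_rank (F (enum_val s)).
have hI : injective h.
  move=> s t /enum_rank_inj/(congr1 val) /= e; apply/enum_val_inj/val_inj.
  apply/matrixP => i j; move/matrixP/(_ i j): e; rewrite !mxE.
  exact: bij_inj.
have hS t : exists s, h s = t.
  case: (fB) => g fK gK.
  have e : map_mx f (map_mx g (val (enum_val t))) = val (enum_val t).
    by apply/matrixP => i j; rewrite !mxE gK.
  have nd : normalized (map_mx g (val (enum_val t))).
    by rewrite -normalized_map e; apply: valP.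
  exists (enum_rank (Sub _ nd : coords R)).
  rewrite /h enum_rankK -[t in RHS]enum_valK; congr enum_rank.
  by apply: val_inj; rewrite /= e.
rewrite -[RHS](char_poly_mxsub _ (injective_surjective_bij hI hS)).
congr char_poly; apply/matrixP => s t; rewrite [RHS]mxE !orthogonality_mx_sqr.
by rewrite /h !enum_rankK card_common_zeros_map //; apply: valP.
Qed.
End Map.

Lemma free_plane_isospectral (f : R -> R') :
    bijective f -> preserves_congruences f ->
  isospectral (free_plane R) (free_plane R').
Proof.
move=> fB fC a; congr mup; congr (_ : {poly algC}).
have [g [gB gC g0 g1]] := preserves_congruences_normalize fB fC.
by rewrite !(free_plane_char_poly chR, free_plane_char_poly chR')
  (orthogonality_char_poly_map gB gC g0 g1).
Qed.
End Transfer.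

(** * Quotients of rings of integers *)

Section IntRing.
Variables (F : dvFieldType) (pi : uniformizer F).
Implicit Types x y z : int_ring F.
Local Notation O := (int_ring F).
Local Notation w := (pi : int_ring F).

Definition int_divides (a x : O) : Prop := exists y, x = a * y.

Lemma unif_mulI k : injective ( *%R (w ^+ k)).
Proof.
move=> x y /(congr1 val); rewrite !rmorphM !rmorphXn /= => e.
by apply/val_inj/(mulfI _ e); rewrite expf_eq0 negb_and unif_neq0 orbT.
Qed.

(** The valuation of [x] is nonnegative and not at least 1, hence 0, so the inverse is integral. *)
Lemma int_divides_unif_inv x : x \notin @max_ideal F -> exists y, x * y = 1.
Proof.
move=> xm; have x0 : val x != 0.
  by apply: contraNneq xm => x0; rewrite unfold_in x0 val_ge0r.
have vx : valuation (val x) = 0.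
  apply/eqP; move: (valP x) xm; rewrite !unfold_in /val_ge (negPf x0) /=.
  case: (valuation (val x)) => -[|n] //.
have yO : (val x)^-1 \in @integral_pred F.
  by rewrite unfold_in /val_ge valuationV // vx orbT.
by exists (IntRing yO); apply: val_inj; rewrite rmorphM /= divff.
Qed.

Local Notation k := (residue_field F).
Local Notation res := (\pi_k)%qT.

Lemma res_eq x y : res x = res y <-> int_divides w (x - y).
Proof.
split=> [/eqP|[z e]]; last apply/eqP.
  by rewrite -Quotient.idealrBE => /(max_idealP pi).
by rewrite -Quotient.idealrBE e; apply: unif_max.
Qed.

(** Reduction modulo the uniformizer recovers the leading digits [a] and [b]; once equal they
    cancel, and one factor of the uniformizer can be removed. *)
Lemma int_divides_digit m (a b : k) x y :
  int_divides (w ^+ m.+1) (repr a + w * x - (repr b + w * y)) <->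
  a = b /\ int_divides (w ^+ m) (x - y).
Proof.
split=> [[z e]|[-> [z e]]]; last first.
  exists z; rewrite exprS -mulrA -e; ring.
have ab : a = b.
  rewrite -[a]reprK -[b]reprK; apply/res_eq; exists (w ^+ m * z - x + y).
  by rewrite mulrDr mulrBr mulrA -exprS -e; ring.
split=> //; exists z; apply: (@unif_mulI 1); rewrite expr1 mulrA -exprS -e ab.
ring.
Qed.

Lemma digit_ex x : exists y, x = repr (res x) + w * y.
Proof.
have [|y e] := (res_eq x (repr (res x))).1; first by rewrite reprK.
by exists y; rewrite -e addrC subrK.
Qed.
End IntRing.

(** * The quotients are chain rings *)

Section IntQuot.
Variables (F : localFieldType) (pi : uniformizer F) (r : nat) (r_gt0 : (0 < r)%N).
Implicit Types x y z : int_ring F.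
Local Notation O := (int_ring F).
Local Notation w := (pi : int_ring F).
Local Notation Q := (int_quot pi r_gt0).

Definition quot_proj : O -> Q := (\pi_Q)%qT.
HB.instance Definition _ := GRing.RMorphism.on quot_proj.
Local Notation proj := quot_proj.

Lemma quot_projK (x : Q) : quot_proj (repr x) = x.
Proof. exact: reprK. Qed.

Lemma proj_eq0 x : proj x = 0 <-> int_divides (w ^+ r) x.
Proof.
rewrite -[0](rmorph0 proj).
split=> [/eqP|H]; last apply/eqP.
  by rewrite -Quotient.idealrBE subr0 => /asboolP.
by rewrite -Quotient.idealrBE subr0; apply/asboolP.
Qed.

(** Lifting an equation from the quotient costs a multiple of [w ^+ r], absorbed into [w ^+ k]
    because [k <= r]. *)
Lemma proj_divides k x : (k <= r)%N ->
  divides (proj w ^+ k) (proj x) <-> int_divides (w ^+ k) x.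
Proof.
move=> kr; split=> [/dividesP[y]|[y ->]]; last first.
  by apply/dividesP; exists (proj y); rewrite rmorphM rmorphXn.
rewrite -[y]quot_projK => /eqP; rewrite -subr_eq0 -rmorphXn -rmorphM -rmorphB.
move=> /eqP/proj_eq0[z e].
exists (repr y + w ^+ (r - k) * z).
by rewrite mulrDr mulrA -exprD subnKC // -e addrC subrK.
Qed.

Lemma int_quot_chain_ring : chain_ring (R := Q) (proj w) r.
Proof.
split=> // [x|k x kr].
  rewrite -[x]quot_projK; have [xm _|/int_divides_unif_inv[y xy]] :=
    boolP (repr x \in @max_ideal F).
    have [y ->] := max_idealP pi xm.
    by apply/dividesP; exists (proj y); rewrite rmorphM.
  by case/negP; apply/is_unitP; exists (proj y); rewrite -rmorphM xy rmorph1.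
rewrite -[x]quot_projK -rmorphXn -rmorphM; apply/eqP/idP.
  move=> /proj_eq0[y e]; apply/proj_divides; first exact: leq_subr.
  exists y; apply: (@unif_mulI _ pi k).
  by rewrite e mulrA -exprD subnKC.
move=> /proj_divides[|y ->]; first exact: leq_subr.
by apply/proj_eq0; exists y; rewrite mulrA -exprD subnKC.
Qed.
End IntQuot.

(* The first [k] digits of [x] in base [pi] are translated one by one through a
   bijection of the residue fields. *)
Lemma digit_map_ex (F F' : dvFieldType) (pi : uniformizer F)
    (pi' : uniformizer F') (beta : residue_field F -> residue_field F') k :
  bijective beta -> exists f : int_ring F -> int_ring F',
    (forall m x y, (m <= k)%N ->
       int_divides (unif pi ^+ m) (x - y) <->
       int_divides (unif pi' ^+ m) (f x - f y)) /\
    (forall z, exists x, int_divides (unif pi' ^+ k) (f x - z)).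
Proof.
move=> betaB; elim: k => [|k [f [fC fS]]].
  exists (fun _ => 0); split=> [[] // x y _|z]; last first.
    by exists 0, (0 - z); rewrite mul1r.
  by split=> _; [exists (0 - 0) | exists (x - y)]; rewrite mul1r.
have [q qE] := choice (digit_ex pi).
pose res := (\pi_(residue_field F))%qT.
(* The leading digit goes through [beta], the tail [q x] through the map for [k] digits. *)
exists (fun x => repr (beta (res x)) + unif pi' * f (q x)).
split=> [[|m] x y mk|z].
- split=> _; [exists (repr (beta (res x)) + unif pi' * f (q x) -
    (repr (beta (res y)) + unif pi' * f (q y))) | exists (x - y)]; by rewrite mul1r.
- rewrite int_divides_digit -(fC m) // {1}(qE x) {1}(qE y) int_divides_digit.
  by split=> -[e H]; split=> //; [rewrite /res e | apply: (bij_inj betaB)].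
have [z' ->] := digit_ex pi' z; have [x' x'E] := fS z'.
case: betaB => gamma betaK gammaK.
pose c := gamma (\pi_(residue_field F') z)%qT.
pose x := repr c + unif pi * x'.
(* Both expansions represent [x], so its digit is [c] and its tail agrees with [x'] modulo the
   [k]-th power. *)
have /int_divides_digit[resx qx] :
    int_divides (unif pi ^+ k.+1)
      (repr (res x) + unif pi * q x - (repr c + unif pi * x')).
  by rewrite -qE subrr; exists 0; rewrite mulr0.
exists x; apply/int_divides_digit; split; first by rewrite resx gammaK.
have /fC-/(_ (leqnn k))[a ea] := qx.
case: x'E => b eb; exists (a + b); rewrite mulrDr -ea -eb; ring.
Qed.

Theorem corollary3p8 (F F' : localFieldType)
    (pi : uniformizer F) (pi' : uniformizer F')
    (eq_residue : #|{: residue_field F}| = #|{: residue_field F'}|)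
    (r : nat) (r_gt0 : (1 <= r)%N) :
  isospectral (free_plane (int_quot pi r_gt0))
              (free_plane (int_quot pi' r_gt0)).
Proof.
have [beta betaB] : exists beta : residue_field F -> residue_field F',
    bijective beta.
  exists (fun x => enum_val (cast_ord eq_residue (enum_rank x))).
  exists (fun y => enum_val (cast_ord (esym eq_residue) (enum_rank y))) => x.
    by rewrite enum_valK cast_ordK enum_rankK.
  by rewrite enum_valK cast_ordKV enum_rankK.
have [f [fC fS]] := digit_map_ex pi pi' r betaB.
(* The class of the result does not depend on the lift [repr x], as [f] respects congruences modulo
   the [r]-th power. *)
pose g (x : int_quot pi r_gt0) := quot_proj pi' r_gt0 (f (repr x)).
have gC : preserves_congruences (quot_proj pi r_gt0 (unif pi))
    (quot_proj pi' r_gt0 (unif pi')) r g.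
  move=> m x y mr; rewrite -{1}[x]quot_projK -{1}[y]quot_projK -!rmorphB.
  apply/idP/idP => /(proj_divides _ _ _ mr)/(fC _ _ _ mr) H;
    exact/(proj_divides _ _ _ mr).
(* In the quotient, congruence modulo the [r]-th power is equality; this gives both injectivity and
   surjectivity of [g]. *)
have quot_eq0 (E : localFieldType) (rho : uniformizer E)
    (x y : int_quot rho r_gt0) :
    divides (quot_proj rho r_gt0 (unif rho) ^+ r) (x - y) -> x = y.
  rewrite (chain_expr0 (int_quot_chain_ring rho r_gt0)) => /dividesP[z].
  by rewrite mul0r; apply: subr0_eq.
apply: (free_plane_isospectral (int_quot_chain_ring pi r_gt0)
  (int_quot_chain_ring pi' r_gt0) (f := g)) => //.
apply: injective_surjective_bij => [x y gxy|z].
  by apply: quot_eq0; rewrite gC // gxy subrr divides0.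
have [x xz] := fS (repr z); exists (quot_proj pi r_gt0 x); apply: quot_eq0.
(* The error splits into the change of lift from [x] to [repr] and the approximation of [repr z] by
   [f x]. *)
have -> : g (quot_proj pi r_gt0 x) - z = quot_proj pi' r_gt0
    (f (repr (quot_proj pi r_gt0 x)) - f x) + quot_proj pi' r_gt0 (f x - repr z).
  by rewrite -rmorphD addrA subrK rmorphB /= quot_projK.
apply: dividesD; last exact/(proj_divides _ _ _ (leqnn r)).
apply/(proj_divides _ _ _ (leqnn r))/(fC _ _ _ (leqnn r)).
apply/(proj_divides _ _ _ (leqnn r)).
by rewrite rmorphB /= quot_projK subrr divides0.
Qed.
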